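(* Let $k \geq 3$ be an integer, let $G$ be the group of units of $\mathbb{Z}/2^k\mathbb{Z}$ (the odd residues mod $2^k$ under multiplication), and let $3^* = \{3^i \bmod 2^k : i \geq 1\}$. Then: (1) $-1 \notin 3^*$, i.e. no power of $3$ is congruent to $-1$ modulo $2^k$. (2) $G$ is not cyclic; it is the direct product $G = C_2 \cdot 3^*$ of the subgroup $C_2 = \{-1, 1\}$ of order $2$ and the cyclic subgroup $3^*$, which has order $|3^*| = 2^{k-2}$. Thus $3$ generates exactly half of the odd residues mod $2^k$, and the other half are their complements (negatives) $\{-x : x \in 3^*\}$. (3) Every non-zero residue $n$ modulo $2^k$ can be written as $n \equiv \pm 3^i \cdot 2^j \pmod{2^k}$ for some choice of sign and integers $0 \leq i < 2^{k-2}$ and $0 \leq j < k$, while $\pm 3^i\cdot 2^j \equiv 0 \pmod{2^k}$ for $j = k$.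
   Context: For a residue $a$ modulo $m$, $a^*$ denotes the set $\{a^i \bmod m : i \geq 1\}$ of all powers of $a$ (its iteration class under multiplication mod $m$). The complement of a residue $x$ is $-x$. *)

(* Defs.v *)
From mathcomp Require Import all_boot all_order all_fingroup all_algebra.
From mathcomp Require Import all_solvable boolp.
Set Implicit Arguments.
Unset Strict Implicit.
Unset Printing Implicit Defensive.
Import GRing.Theory.
Local Open Scope ring_scope.

(* 'Z_m is the ring of residues mod m only for m >= 2. *)
Definition iter_class (m : nat) (a : 'Z_m) : {set 'Z_m} :=
  [set x : 'Z_m | `[< exists i : nat, (1 <= i)%N /\ x = a ^+ i >]].

(* The parity of a residue mod m is intrinsic only when m is even. *)
Definition odd_residues (m : nat) : {set 'Z_m} :=
  [set x : 'Z_m | odd (x : nat)].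

(* A set of units of Z/mZ, seen as a set of residues. *)
Definition residues_of (m : nat) (A : {set {unit 'Z_m}}) : {set 'Z_m} :=
  [set FinRing.uval u | u in A].

(* Main.v *)
Require Import Defs.
From mathcomp Require Import all_boot all_order all_fingroup all_algebra.
From mathcomp Require Import all_solvable boolp.
From mathcomp Require Import ring zify.
Import GRing.Theory.
Local Open Scope ring_scope.

(** Everything follows from two facts about powers of 3 as natural numbers.

    Modulo 8 they only take the values 1 and 3, so 8, and a fortiori [2 ^ k]
    with [3 <= k], never divides [3 ^ i + 1]: the residue -1 is not a power of 3
    ([expr3_neqN1]).

    Repeated squaring of [3 ^ 2 = 2 ^ 3 + 1] shows that the exponent of 2 in
    [3 ^ (2 ^ n) - 1] is exactly [n + 2] for positive [n] ([expn3_pow2E]).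
    Hence 3 has order [2 ^ (k - 2)] modulo [2 ^ k] ([order_unit3]).

    The subgroups generated by -1 and by 3 therefore meet trivially, and the
    product of their orders is [2 ^ (k - 1)], the number of units, so the group
    of units is their direct product ([dprod_units]). Both factors have even
    order, so the product is not cyclic, and the complement of the subgroup
    generated by 3 is its coset by -1 ([setD_cycle3]). A nonzero residue is a
    unit times a power of 2 with exponent less than [k] ([Zp_pow2_factor]), which
    gives the normal form of the nonzero residues.

    The group arguments take place in the type of units, whose elements are sent
    to residues by the injection [FinRing.uval]; the units -1 and 3 enter the
    lemmas as variables [w] and [u] characterised by their residues. *)

(** * Powers of 3 as natural numbers *)

Lemma ndvdn8_expn3_add1 (i : nat) : ~~ (8 %| 3 ^ i + 1)%N.
Proof.
have [h1|h3]: (3 ^ i %% 8 = 1)%N \/ (3 ^ i %% 8 = 3)%N.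
- elim: i => [|i [IHi|IHi]]; first by left.
  + by right; rewrite expnS -modnMmr IHi.
  + by left; rewrite expnS -modnMmr IHi.
- by rewrite /dvdn -modnDml h1.
- by rewrite /dvdn -modnDml h3.
Qed.

(** Each squaring gains exactly one factor 2: the square of [2 ^ e * q + 1]
    is [2 ^ e.+1 * (2 ^ e.-1 * q ^ 2 + q) + 1], whose
    cofactor is again odd as soon as [e] is at least 2. *)
Lemma expn3_pow2E (n : nat) :
  exists2 q, odd q & (3 ^ (2 ^ n.+1) = 2 ^ n.+3 * q + 1)%N.
Proof.
elim: n => [|n [q odd_q E]]; first by exists 1%N.
exists (2 ^ n.+2 * q ^ 2 + q)%N.
  by rewrite oddD odd_q expnS -mulnA mul2n odd_double.
rewrite [in LHS]expnSr expnM {}E [(2 ^ n.+4)%N]expnS [(2 ^ n.+3)%N]expnS.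
move: (2 ^ n.+2)%N => a; ring.
Qed.

Lemma dvdn_expn3_pow2_sub1 (n j : nat) :
  (2 ^ j %| 3 ^ (2 ^ n.+1) - 1)%N = (j <= n.+3)%N.
Proof.
have [q odd_q ->] := expn3_pow2E n.
rewrite addnK; have [le_jn|lt_nj] := leqP j n.+3.
  by rewrite dvdn_mulr // dvdn_exp2l.
apply: contraTF odd_q => dvd_q.
have: (2 ^ n.+4 %| 2 ^ n.+3 * q)%N by apply: dvdn_trans dvd_q; rewrite dvdn_exp2l.
by rewrite expnSr dvdn_pmul2l ?expn_gt0 // dvdn2.
Qed.

(** The bound that keeps the order of 3 from being smaller than [2 ^ (k - 2)].
    The case [n = 0], where [3 - 1 = 2], escapes the general valuation formula
    and is needed for [k = 3]. *)
Lemma ndvdn_expn3_pow2_sub1 (n : nat) : ~~ (2 ^ n.+3 %| 3 ^ (2 ^ n) - 1)%N.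
Proof.
case: n => [//|n]; by rewrite dvdn_expn3_pow2_sub1 ltnn.
Qed.

(** * Residues and units modulo a power of 2 *)

Lemma Zp_natr_eq0 (m n : nat) : (1 < m)%N -> ((n%:R : 'Z_m) == 0) = (m %| n)%N.
Proof. by move=> m_gt1; rewrite -val_eqE /= val_Zp_nat. Qed.

Lemma Zp_expr3_eq1 (m n : nat) :
  (1 < m)%N -> ((3 : 'Z_m) ^+ n == 1) = (m %| 3 ^ n - 1)%N.
Proof.
by move=> m_gt1; rewrite -Zp_natr_eq0 // natrB ?expn_gt0 // natrX subr_eq0.
Qed.

Lemma expr3_neqN1 (k i : nat) :
  (3 <= k)%N -> (3 : 'Z_(2 ^ k)) ^+ i != -1.
Proof.
move=> k_ge3; have m_gt1 : (1 < 2 ^ k)%N by rewrite -{1}(expn0 2) ltn_exp2l //; lia.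
apply: contra (ndvdn8_expn3_add1 i) => /eqP pow3E.
apply: (@dvdn_trans (2 ^ k)); first exact: (dvdn_exp2l 2 k_ge3).
by rewrite -(Zp_natr_eq0 (2 ^ k)) // natrD natrX pow3E addNr.
Qed.

Lemma unit_Zp_pow2 (k : nat) (x : 'Z_(2 ^ k)) :
  (0 < k)%N -> (x \is a GRing.unit) = odd x.
Proof.
move=> k_gt0; have m_gt1 : (1 < 2 ^ k)%N by rewrite -{1}(expn0 2) ltn_exp2l.
by rewrite -[x in LHS]natr_Zp unitZpE // coprime_pexpl // coprime2n.
Qed.

Lemma residues_of_setT (k : nat) :
  (0 < k)%N -> residues_of [set: {unit 'Z_(2 ^ k)}] = odd_residues (2 ^ k).
Proof.
move=> k_gt0; apply/setP=> x; rewrite inE -unit_Zp_pow2 //.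
apply/imsetP/idP=> [[u _ ->]|x_unit]; first exact: valP.
by exists (FinRing.unit 'Z_(2 ^ k) x_unit).
Qed.

Lemma uval_inj (m : nat) : injective (@FinRing.uval 'Z_m).
Proof. exact: val_inj. Qed.

Lemma uvalM (m : nat) (u v : {unit 'Z_m}) :
  FinRing.uval (u * v)%g = FinRing.uval u * FinRing.uval v.
Proof. exact: FinRing.val_unitM. Qed.

Lemma uvalX (m n : nat) (u : {unit 'Z_m}) :
  FinRing.uval (u ^+ n)%g = FinRing.uval u ^+ n.
Proof. exact: FinRing.val_unitX. Qed.

Lemma card_residues_of (m : nat) (A : {set {unit 'Z_m}}) :
  #|residues_of A| = #|A|.
Proof. exact/card_imset/uval_inj. Qed.

(** The powers with positive exponents already contain the unit element: adding
    the order to an exponent makes it positive without changing the power. *)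
Lemma residues_of_cycle (m : nat) (u : {unit 'Z_m}) :
  residues_of <[u]>%g = iter_class (FinRing.uval u).
Proof.
apply/setP=> x; rewrite inE; apply/imsetP/asboolP.
  case=> _ /cycleP[i ->] ->; exists (i + #[u]%g)%N.
  by rewrite addn_gt0 order_gt0 orbT -uvalX expgD expg_order mulg1.
by case=> i [_ ->]; exists (u ^+ i)%g; rewrite ?mem_cycle ?uvalX.
Qed.

(** * The decomposition of the group of units *)

(** By [dvdn_expn3_pow2_sub1] the order divides [2 ^ (k - 2)], so it is a power
    of 2; a smaller one would divide [2 ^ (k - 3)], against
    [ndvdn_expn3_pow2_sub1]. *)
Lemma order_unit3 (k : nat) (u : {unit 'Z_(2 ^ k)}) :
  (3 <= k)%N -> FinRing.uval u = 3 -> #[u]%g = (2 ^ (k - 2))%N.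
Proof.
case: k u => [|[|[|n]]] // u _ u3; rewrite subn2 /=.
have m_gt1 : (1 < 2 ^ n.+3)%N by rewrite -{1}(expn0 2) ltn_exp2l.
have uX1 j : (u ^+ j == 1)%g = (2 ^ n.+3 %| 3 ^ j - 1)%N.
  by rewrite -Zp_expr3_eq1 // -u3 -uvalX -val_eqE.
have: (#[u]%g %| 2 ^ n.+1)%N by rewrite order_dvdn uX1 dvdn_expn3_pow2_sub1.
case/dvdn_pfactor=> // e; rewrite leq_eqVlt => /predU1P[-> //|lt_en] ord_u.
have /negP[] := ndvdn_expn3_pow2_sub1 n.
by rewrite -uX1 -order_dvdn ord_u dvdn_exp2l.
Qed.

Lemma order_unitN1 (m : nat) (w : {unit 'Z_m}) :
  (2 < m)%N -> FinRing.uval w = -1 -> #[w]%g = 2%N.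
Proof.
move=> m_gt2 wN1; apply: nt_prime_order => //.
  by apply: uval_inj; rewrite uvalX wN1 sqrrN expr1n.
apply/eqP=> w1; have m_gt1 := ltnW m_gt2.
have: ((1 + 1)%:R : 'Z_m) == 0 by rewrite natrD addr_eq0 -wN1 w1.
by rewrite Zp_natr_eq0 // gtnNdvd.
Qed.

Lemma unitN1_notin_cycle3 (k : nat) (w u : {unit 'Z_(2 ^ k)}) :
  (3 <= k)%N -> FinRing.uval w = -1 -> FinRing.uval u = 3 -> w \notin <[u]>%g.
Proof.
move=> k_ge3 wN1 u3; apply/negP=> /cycleP[i w_u].
by have /eqP[] := expr3_neqN1 k i k_ge3; rewrite -u3 -wN1 w_u uvalX.
Qed.

(** The cyclic group of -1 has prime order 2 and its generator is not a power of
    3, so the two subgroups meet trivially; a count against the totient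
    [2 ^ (k - 1)] then shows that they fill the group of units. *)
Lemma dprod_units (k : nat) (w u : {unit 'Z_(2 ^ k)}) :
  (3 <= k)%N -> FinRing.uval w = -1 -> FinRing.uval u = 3 ->
  (<[w]> \x <[u]>)%g = [set: {unit 'Z_(2 ^ k)}].
Proof.
move=> k_ge3 wN1 u3.
have m_gt2 : (2 < 2 ^ k)%N by rewrite -{1}(expn1 2) ltn_exp2l // ltnW.
have ord_w := order_unitN1 _ _ m_gt2 wN1.
have TI : <[w]>%g :&: <[u]>%g = 1%g.
  by rewrite prime_TIg ?ord_w -?orderE ?ord_w // cycle_subG unitN1_notin_cycle3.
have cuw : <[u]>%g \subset 'C(<[w]>)%g.
  by rewrite cents_cycle //; apply: uval_inj; rewrite !uvalM mulrC.
rewrite dprodE //; apply/eqP; rewrite eqEcard subsetT /= TI_cardMg //.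
rewrite -!orderE ord_w (order_unit3 _ _ k_ge3 u3).
rewrite (@card_units_Zp (2 ^ k)) ?expn_gt0 // totient_pfactor //; last by lia.
by rewrite mul1n -expnS; apply: leq_pexp2l => //; lia.
Qed.


Lemma unit_eqN1X3X (k : nat) (w u g : {unit 'Z_(2 ^ k)}) :
  (3 <= k)%N -> FinRing.uval w = -1 -> FinRing.uval u = 3 ->
  exists (s : bool) (i : nat), (i < 2 ^ (k - 2))%N /\ g = (w ^+ s * u ^+ i)%g.
Proof.
move=> k_ge3 wN1 u3.
have m_gt2 : (2 < 2 ^ k)%N by rewrite -{1}(expn1 2) ltn_exp2l // ltnW.
have [y [z [/cyclePmin[s lt_s ->] /cyclePmin[i lt_i ->] -> _]]] :=
  mem_dprod (dprod_units _ _ _ k_ge3 wN1 u3) (in_setT g).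
move: lt_s lt_i; rewrite (order_unitN1 _ _ m_gt2 wN1) (order_unit3 _ _ k_ge3 u3).
by case: s => [|[|//]] _ lt_i; [exists false, i | exists true, i].
Qed.

(** The group form of the assertion that the odd residues outside the powers of 3
    are the negatives of the powers of 3: the subgroup has index 2, and -1
    represents its other coset. *)
Lemma setD_cycle3 (k : nat) (w u : {unit 'Z_(2 ^ k)}) :
  (3 <= k)%N -> FinRing.uval w = -1 -> FinRing.uval u = 3 ->
  ~: <[u]>%g = (w *: <[u]>)%g.
Proof.
move=> k_ge3 wN1 u3; have w_notin := unitN1_notin_cycle3 _ _ _ k_ge3 wN1 u3.
apply/setP=> g; rewrite inE mem_lcoset.
have [s [i [_ ->]]] := unit_eqN1X3X _ _ _ g k_ge3 wN1 u3.
have ui : (u ^+ i)%g \in <[u]>%g by exact: mem_cycle.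
case: s; first by rewrite expg1 groupMr // w_notin mulKg ui.
by rewrite expg0 mul1g ui groupMr // groupV (negbTE w_notin).
Qed.

(** A direct product of cyclic groups is cyclic only if their orders are coprime;
    here both are even because [3 <= k]. *)
Lemma ncyclic_units (k : nat) (w u : {unit 'Z_(2 ^ k)}) :
  (3 <= k)%N -> FinRing.uval w = -1 -> FinRing.uval u = 3 ->
  ~~ cyclic [set: {unit 'Z_(2 ^ k)}].
Proof.
move=> k_ge3 wN1 u3.
have m_gt2 : (2 < 2 ^ k)%N by rewrite -{1}(expn1 2) ltn_exp2l // ltnW.
rewrite (cyclic_dprod (dprod_units _ _ _ k_ge3 wN1 u3)) ?cycle_cyclic //.
rewrite -!orderE (order_unitN1 _ _ m_gt2 wN1) (order_unit3 _ _ k_ge3 u3).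
by rewrite coprime2n oddX /= orbF subn_eq0 -ltnNge.
Qed.

(** * Residues with an even part *)

(** Split the representative of [n] in the interval from 1 to [2 ^ k - 1] into its
    odd part, which is a unit, and its power of 2, which is less than [2 ^ k]. *)
Lemma Zp_pow2_factor (k : nat) (n : 'Z_(2 ^ k)) :
  (0 < k)%N -> n != 0 ->
  exists (g : {unit 'Z_(2 ^ k)}) (j : nat),
    (j < k)%N /\ n = FinRing.uval g * 2 ^+ j.
Proof.
move=> k_gt0 n_neq0; have m_gt1 : (1 < 2 ^ k)%N by rewrite -{1}(expn0 2) ltn_exp2l.
have n_gt0 : (0 < n)%N by rewrite lt0n.
have n_lt : (n < 2 ^ k)%N by rewrite -[X in (_ < X)%N](Zp_cast m_gt1).
have [q co_q nE] := pfactor_coprime (isT : prime 2) n_gt0.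
have q_unit : (q%:R : 'Z_(2 ^ k)) \is a GRing.unit.
  by rewrite unitZpE // coprimeXl.
exists (FinRing.unit 'Z_(2 ^ k) q_unit), (logn 2 n); split.
  rewrite -(@ltn_exp2l 2) //; apply: leq_ltn_trans n_lt.
  by rewrite dvdn_leq // pfactor_dvdnn.
by rewrite /= -[LHS]natr_Zp {1}nE natrM natrX.
Qed.

Theorem mainTheorem1 (k : nat) (hk : (3 <= k)%N) :
  let m := (2 ^ k)%N in
  let G : {group {unit 'Z_m}} := [set: {unit 'Z_m}]%G in
  let three_star : {set 'Z_m} := iter_class (3 : 'Z_m) in
  (* (1) *)
  ((-1 : 'Z_m) \notin three_star /\
   (forall i : nat, (1 <= i)%N -> (3 : 'Z_m) ^+ i != -1)) /\
  (* (2) *)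
  (residues_of G = odd_residues m /\
   ~~ cyclic G /\
   (exists (C2 : {group {unit 'Z_m}}) (u3 : {unit 'Z_m}),
      [/\ residues_of C2 = [set -1; 1],
          #|C2| = 2%N,
          FinRing.uval u3 = 3,
          residues_of <[u3]>%g = three_star
        & (C2 \x <[u3]>)%g = G]) /\
   #|three_star| = (2 ^ (k - 2))%N /\
   #|odd_residues m| = (2 * #|three_star|)%N /\
   odd_residues m :\: three_star = [set - x | x in three_star]) /\
  (* (3) *)
  ((forall n : 'Z_m, n != 0 ->
      exists (s : bool) (i j : nat),
        [/\ (i < 2 ^ (k - 2))%N, (j < k)%N
          & n = (-1) ^+ s * 3 ^+ i * 2 ^+ j]) /\
   (forall (s : bool) (i : nat),
      (-1) ^+ s * 3 ^+ i * 2 ^+ k = 0 :> 'Z_m)).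
Proof.
lazy zeta.
have m_gt2 : (2 < 2 ^ k)%N by rewrite -{1}(expn1 2) ltn_exp2l // ltnW.
have m_gt1 := ltnW m_gt2.
have k_gt0 : (0 < k)%N by apply: leq_trans hk.
have unitN1 : (-1 : 'Z_(2 ^ k)) \is a GRing.unit by rewrite unitrN unitr1.
have unit3 : (3 : 'Z_(2 ^ k)) \is a GRing.unit by rewrite unitZpE // coprimeXl.
pose w := FinRing.unit 'Z_(2 ^ k) unitN1.
pose u := FinRing.unit 'Z_(2 ^ k) unit3.
have wN1 : FinRing.uval w = -1 by [].
have u3 : FinRing.uval u = 3 by [].
have ord_w := order_unitN1 _ _ m_gt2 wN1.
have ord_u := order_unit3 _ _ hk u3.
have dprodG := dprod_units _ _ _ hk wN1 u3.
have -> : iter_class (3 : 'Z_(2 ^ k)) = residues_of <[u]>%g.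
  by rewrite residues_of_cycle u3.
rewrite -residues_of_setT //.
split; [|split; [|split]].
- split=> [|i _]; last exact: expr3_neqN1.
  rewrite -wN1 (mem_imset _ _ (@uval_inj _)).
  exact: unitN1_notin_cycle3 hk wN1 u3.
- split=> //; split; first exact: ncyclic_units hk wN1 u3.
  split; [|split; [|split]].
  + exists <[w]>%G, u; split=> //.
    by rewrite /residues_of /= cycle2g // imsetU1 imset_set1 wN1 setUC.
  + by rewrite card_residues_of -orderE ord_u.
  + by rewrite !card_residues_of -(dprod_card dprodG) -!orderE ord_w.
  + have opp_uval v : - FinRing.uval v = FinRing.uval (w * v)%g.
      by rewrite uvalM wN1 mulN1r.
    apply/setP=> x; apply/setDP/imsetP.
      case=> /imsetP[g _ ->]; rewrite (mem_imset _ _ (@uval_inj _)) -in_setC.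
      rewrite (setD_cycle3 _ _ _ hk wN1 u3) => /lcosetP[v v_u ->].
      by exists (FinRing.uval v); rewrite ?opp_uval ?imset_f.
    case=> _ /imsetP[v v_u ->] ->; rewrite opp_uval; split; first exact: imset_f.
    rewrite (mem_imset _ _ (@uval_inj _)) -in_setC.
    by rewrite (setD_cycle3 _ _ _ hk wN1 u3) mem_lcoset mulKg.
- move=> n n_neq0; have [g [j [lt_j ->]]] := Zp_pow2_factor _ _ k_gt0 n_neq0.
  have [s [i [lt_i ->]]] := unit_eqN1X3X _ _ _ g hk wN1 u3.
  by exists s, i, j; rewrite uvalM !uvalX wN1 u3.
- move=> s i; have: ((2 ^ k)%:R : 'Z_(2 ^ k)) == 0 by rewrite Zp_natr_eq0.
  by rewrite natrX => /eqP->; rewrite mulr0.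
Qed.
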